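(* Let $Q$ be an $n$-dimensional manifold with a rank-$m$ nonholonomic constraint distribution $\mathcal D$, constraint submanifold $\mathcal C\subset TQ$, and an adapted frame $\{X_i\}=\{X_\alpha,X_a\}$ with quasi-velocities $v^i$. Let $L$ be a regular Lagrangian on $TQ$. (1) If there is a section $\phi:\mu_a=\phi_a$ of $\mathcal C\times\mathbb R^{n-m}\to\mathcal C$ such that the solution $\hat\Gamma=\Gamma_{\mathcal C}+\Gamma_\mu$ of the vakonomic problem on $\operatorname{im}(\phi)$ is tangent to $\operatorname{im}(\phi)$, where $\Gamma_\mu$ is chosen such that $\Gamma_{\mathcal C}$ is tangent to $\mathcal C$, then $\Gamma_{\mathcal C}$ is the restriction to $\mathcal C$ of an Euler-Lagrange field of $\tilde L=L-\Phi_av^a$ for any extension of the $\phi_a$ off $\mathcal C$, i.e. for any functions $\Phi_a$ defined on a neighbourhood of $\mathcal C$ in $TQ$ with $\Phi_a|_{\mathcal C}=\phi_a$. (2) Conversely, let $\tilde\Gamma$ be an Euler-Lagrange field of $\tilde L=L-\Phi_av^a$, where the $\Phi_a$ are functions defined on a neighbourhood of $\mathcal C$ in $TQ$; suppose that $\tilde\Gamma$ is tangent to $\mathcal C$. Let $\phi_a=\Phi_a|_{\mathcal C}$ and consider the section $\phi:\mu_a=\phi_a$. Then $\phi_*\tilde\Gamma^0$, where $\tilde\Gamma^0$ is the restriction of $\tilde\Gamma$ to $\mathcal C$, is a solution of the vakonomic problem on the image of $\phi$.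
   Context: All considerations are local: $Q$ may be taken to be the domain of the frame. Summation convention. Local coordinates $q^i$ on $Q$, with natural fibre coordinates $u^i$ on $TQ$. For a vector field $Z=Z^i\,\partial/\partial q^i$ on $Q$, its vertical lift to $TQ$ is $Z^{\mathrm V}=Z^i\frac{\partial}{\partial u^i}$. $\mathcal D$ is a non-integrable smooth distribution on $Q$ of constant rank $m$, and $\mathcal C=\{(q,u)\in TQ:u\in\mathcal D_q\}$. An adapted frame is a frame $\{X_i\}$, $i=1,\dots,n$, on $Q$ whose first $m$ members $\{X_\alpha\}$, $\alpha=1,\dots,m$, span $\mathcal D$; the others are $\{X_a\}$, $a=m+1,\dots,n$. Its dual coframe is $\{\theta^i\}$; the quasi-velocities are the functions $v^i(q,u)=\theta^i_q(u)$ on $TQ$, so $\mathcal C$ is given by $v^a=0$. $L$ is regular if its Hessian with respect to the velocities is nonsingular. Euler-Lagrange fields: for a Lagrangian $\tilde L$ (not necessarily regular) on an open subset of $TQ$, the Cartan 2-form is $\tilde\omega=d\big(X_i^{\mathrm V}(\tilde L)\theta^i\big)$ and the energy is $\tilde E=v^iX_i^{\mathrm V}(\tilde L)-\tilde L$ (pullbacks of forms from $Q$ are not indicated). Any vector field $\tilde\Gamma$ satisfying $\tilde\Gamma\lrcorner\tilde\omega=-d\tilde E$ is called an Euler-Lagrange field of $\tilde L$. Vakonomic problem: on $TQ\times\mathbb R^{n-m}$ (coordinates $\mu_a$ on $\mathbb R^{n-m}$) consider $\hat L=L-\mu_av^a$, with Cartan 2-form $\hat\omega=d\big(X_i^{\mathrm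 V}(L)\theta^i-\mu_a\theta^a\big)$ and energy $\hat E=E=v^iX_i^{\mathrm V}(L)-L$ (pullbacks not indicated; the velocities corresponding to the $\mu_a$ play no role and are dropped). A solution of the vakonomic problem is a vector field $\hat\Gamma$ satisfying $\hat\Gamma\lrcorner\hat\omega=-d\hat E$; solutions exist only at points of $\mathcal C\times\mathbb R^{n-m}$. A section $\phi$ is given by functions $\phi_a$ on $\mathcal C$, and $\operatorname{im}(\phi)=\{(w,\mu):w\in\mathcal C,\ \mu_a=\phi_a(w)\}$. A solution on $\operatorname{im}(\phi)$ assigns to each point of $\operatorname{im}(\phi)$ a tangent vector to $TQ\times\mathbb R^{n-m}$ there (a priori not tangent to $\operatorname{im}(\phi)$ or to $\mathcal C\times\mathbb R^{n-m}$) satisfying the equation above; it decomposes as $\hat\Gamma=\Gamma_{\mathcal C}+\Gamma_\mu$ according to the product structure, where $\Gamma_\mu=A_a\,\partial/\partial\mu_a$ with $A_a$ functions on $\mathcal C$ that may be chosen freely, and $\Gamma_{\mathcal C}$ (regarded as a field of tangent vectors to $TQ$ at points of $\mathcal C$) is then determined by this choice. ''$\Gamma_\mu$ chosen such that $\Gamma_{\mathcal C}$ is tangent to $\mathcal C$'' means that the $A_a$ are chosen so that this tangency holds.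
   Formalization: In (1) the Euler-Lagrange equation of the extended field is required only at points of C, not on a neighbourhood; in (2) the field is also assumed second order on C (its projection to Q at u equals u); both literal claims fail when the modified Lagrangian is singular. *)

(* Defs.v *)
From HB Require Import structures.
From mathcomp Require Import all_boot all_order all_algebra.
From mathcomp Require Import all_classical all_reals all_analysis.
Set Implicit Arguments.
Unset Strict Implicit.
Unset Printing Implicit Defensive.
Import Order.TTheory GRing.Theory Num.Theory.
Import numFieldNormedType.Exports.
Local Open Scope classical_set_scope.
Local Open Scope ring_scope.

Section Smoothness.
Context {R : realType}.

(* On a finite-dimensional [V] (the only case used) and an open [U] this is
   the class C^p. *)
Fixpoint Cdiff {V W : normedModType R} (p : nat) (U : set V) (f : V -> W)
    : Prop :=
  match p with
  | 0 => forall x, U x -> {for x, continuous f}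
  | p'.+1 => (forall x, U x -> differentiable f x) /\
             (forall v, Cdiff p' U (fun x => 'D_v f x))
  end.

Definition smooth {V W : normedModType R} (U : set V) (f : V -> W) : Prop :=
  forall p, Cdiff p U f.

(* Smoothness of a function that is only meaningful on an arbitrary subset
   [S] (typically a submanifold): it is locally the restriction to [S] of a
   smooth function on an open set. *)
Definition smooth_on {V W : normedModType R} (S : set V) (f : V -> W) : Prop :=
  forall x, S x -> exists (U : set V) (g : V -> W),
    [/\ open U, U x, smooth U g & forall y, U y -> S y -> g y = f y].

(* Velocities at [x] of the smooth curves lying in [S]; this is the tangent
   space T_x S when [S] is an embedded submanifold. *)
Definition tangent_to {V : normedModType R} (S : set V) (x v : V) : Prop :=
  exists (e : R) (c : R -> V),
    [/\ 0 < e, smooth `]-e, e[ c, c 0 = x, derive1 c 0 = v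
      & forall t : R, - e < t < e -> S (c t)].

(* A 1-form on an open subset of [V] is a function of a point and a tangent
   vector, linear in the latter; the directional derivatives below are taken
   with the tangent vectors extended as constant vector fields, so that their
   bracket does not contribute. *)
Definition ext_d {V : normedModType R} (alpha : V -> V -> R) (x v w : V) : R :=
  'D_v (fun y => alpha y w) x - 'D_w (fun y => alpha y v) x.

(* g _| d alpha = - d E  at the point [x] *)
Definition hamilton_eq {V : normedModType R} (alpha : V -> V -> R)
    (E : V -> R) (x g : V) : Prop :=
  forall w, ext_d alpha x g w = - 'D_w E x.

End Smoothness.

(* [Q] is an open subset of R^(m + k), m being the rank of the distribution
   and k its corank. The index [lshift k al] is the al-th of the first m
   indices, [rshift m a] the a-th of the last k ones. A point (or a tangent
   vector) of TQ is a pair of row vectors, [w.1] being the coordinates q^i and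
   [w.2] the fibre coordinates u^i; a point (or a tangent vector) of
   TQ x R^k is a pair whose second component has the coordinates mu_a.
   Covectors are columns. *)
Notation vel_space R n := ('rV[R]_n * 'rV[R]_n)%type (only parsing).

Section Mechanics.
Context {R : realType} {m k : nat}.
Local Notation n := (m + k)%N.
Local Notation base := 'rV[R]_n.
Local Notation TB := (vel_space R n).
Local Notation TBM := (vel_space R n * 'rV[R]_k)%type.

Implicit Types (Q : set base) (D : base -> set base).
Implicit Types (X : 'I_n -> base -> base) (theta : 'I_n -> base -> 'cV[R]_n).

Definition pairing (p : 'cV[R]_n) (u : base) : R := (u *m p) 0 0.

Definition tangent_bundle Q : set TB := [set w | Q w.1].

Definition constraint Q D : set TB := [set w | Q w.1 /\ D w.1 w.2].

Definition adapted_frame Q D X : Prop :=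
  [/\ forall i, smooth Q (X i),
      forall q, Q q -> \matrix_(i < n) X i q \in unitmx
    & forall q, Q q -> forall u,
        D q u <-> exists c : 'rV[R]_m, u = \sum_al c 0 al *: X (lshift k al) q].

Definition dual_coframe Q X theta : Prop :=
  (forall i, smooth Q (theta i)) /\
  (forall q, Q q -> forall i j, pairing (theta i q) (X j q) = (i == j)%:R).

(* Every point of [Q] lies on an integral manifold, given by a parametrization
   [s] of a neighbourhood of the point in it; [s] is an immersion since [D]
   has rank m. *)
Definition integrable_distribution Q D : Prop :=
  forall q, Q q -> exists (W : set 'rV[R]_m) (s : 'rV[R]_m -> base),
    [/\ open W, W 0, s 0 = q, smooth W s
      & forall t, W t -> Q (s t) /\
          forall u, D (s t) u <-> exists h, u = 'D_h s t].

Definition quasi_velocity theta (i : 'I_n) (w : TB) : R :=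
  pairing (theta i w.1) w.2.

(* Z^V (f) *)
Definition vlift (Z : base -> base) (f : TB -> R) (w : TB) : R :=
  'D_(0, Z w.1) f w.

Definition velocity_hessian (L : TB -> R) (w : TB) : 'M[R]_n :=
  \matrix_(i, j) vlift (fun=> delta_mx 0 i) (vlift (fun=> delta_mx 0 j) L) w.

Definition regular_lagrangian Q (L : TB -> R) : Prop :=
  forall w, tangent_bundle Q w -> velocity_hessian L w \in unitmx.

(* X_i^V(L) theta^i, pulled back to TQ *)
Definition cartan_form X theta (L : TB -> R) (w z : TB) : R :=
  \sum_i vlift (X i) L w * pairing (theta i w.1) z.1.

Definition energy X theta (L : TB -> R) (w : TB) : R :=
  \sum_i quasi_velocity theta i w * vlift (X i) L w - L w.

(* Smooth vector field [G] on the open set [N] satisfying the Euler-Lagrange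
   equations of [L] at the points of [S]. With [S = N] it is an Euler-Lagrange
   field on [N]; with [S] smaller, the equations, which may have no solution
   elsewhere when [L] is not regular, are only imposed along [S]. *)
Definition EL_field X theta (N S : set TB) (L : TB -> R) (G : TB -> TB)
    : Prop :=
  smooth N G /\
  forall w, S w -> hamilton_eq (cartan_form X theta L) (energy X theta L) w (G w).

Definition second_order_on (S : set TB) (G : TB -> TB) : Prop :=
  forall w, S w -> (G w).1 = w.2.

(* L - Phi_a v^a *)
Definition modified_lagrangian theta (L : TB -> R) (Phi : TB -> 'rV[R]_k)
    (w : TB) : R :=
  L w - \sum_a Phi w 0 a * quasi_velocity theta (rshift m a) w.

(* X_i^V(L) theta^i - mu_a theta^a, on TQ x R^k *)
Definition vak_form X theta (L : TB -> R) (z v : TBM) : R :=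
  cartan_form X theta L z.1 v.1
  - \sum_a z.2 0 a * pairing (theta (rshift m a) z.1.1) v.1.1.

Definition vak_energy X theta (L : TB -> R) (z : TBM) : R :=
  energy X theta L z.1.

Definition vak_solution_on X theta (L : TB -> R) (S : set TBM)
    (G : TBM -> TBM) : Prop :=
  smooth_on S G /\
  forall z, S z -> hamilton_eq (vak_form X theta L) (vak_energy X theta L) z (G z).

(* im(phi); only the values of [phi] on [C] matter *)
Definition section_image (C : set TB) (phi : TB -> 'rV[R]_k) : set TBM :=
  [set z | C z.1 /\ z.2 = phi z.1].

(* Gamma_C, a field of tangent vectors to TQ along C *)
Definition base_part (phi : TB -> 'rV[R]_k) (G : TBM -> TBM) (w : TB) : TB :=
  (G (w, phi w)).1.

(* phi_* G, a field along the image of the section [w |-> (w, Phi w)] of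
   C x R^k. Here [Phi] is smooth on a neighbourhood of C and [G] is tangent to
   C, so the tangent map of the section sends [G w] to the differential at [w]
   of the extended map applied to [G w]. *)
Definition pushforward_field (Phi : TB -> 'rV[R]_k) (G : TB -> TB) (z : TBM) : TBM :=
  'd (fun w : TB => (w, Phi w) : TBM) (z.1 : TB) (G z.1).

End Mechanics.

(* Main.v *)
(** Since [sum_i theta^i(u) X_i = u], the frame drops out of the Cartan form and
    of the energy: at [y = (q, u)] they are [z |-> dL_y (z.1)^V] and
    [dL_y u^V - L y].  Along [C], where [v^a = 0], let [g] be a second-order
    vector tangent to [C], so that [dv^a] and [theta^a] vanish on it.  The terms by
    which the Euler-Lagrange equation of [L - Phi_a v^a] differs from that of
    [L] then reduce to [dPhi_a(g) theta^a + Phi_a (g _| dtheta^a)]: the two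
    contributions [(g.1)^V(Phi_a) dv^a] and [u^V(Phi_a) dv^a], from the Cartan
    form and from the energy, cancel because [g.1 = u].  This is exactly the
    vakonomic equation at [mu = Phi] for the tangent vector [(g, dPhi(g))].
    In part (1), the vakonomic equation tested on vertical vectors gives
    [g.1 = u] by regularity, and tangency to the image of the section gives the
    second component [dPhi(g)]. *)

Require Import Defs.
From HB Require Import structures.
From mathcomp Require Import all_boot all_order all_algebra.
From mathcomp Require Import all_classical all_reals all_analysis.
From mathcomp Require Import ring lra.
Set Implicit Arguments.
Unset Strict Implicit.
Unset Printing Implicit Defensive.
Import Order.TTheory GRing.Theory Num.Theory.
Import numFieldNormedType.Exports.
Local Open Scope classical_set_scope.
Local Open Scope ring_scope.

(** * Calculus of C^p maps *)

Section Calculus.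
Context {R : realType}.
Implicit Types (V W Z : normedModType R).

(** The difference [g - f] vanishes near [x], so the zero map satisfies the little-o
    characterisation of its differential. *)
Lemma near_eq_differentiable V W (f g : V -> W) (x : V) :
  (\forall y \near x, f y = g y) -> differentiable f x -> differentiable g x.
Proof.
move=> fg df; have -> : g = f + (g - f) by rewrite addrC subrK.
apply: differentiableD => //.
have h0 : \forall h \near (0:V), (g - f) (h + x) = 0.
  have c : (h + x) @[h --> (0 : V)] --> x.
    suff : (h + x) @[h --> (0 : V)] --> 0 + x by rewrite add0r.
    exact: (cvgD (@cvg_id _ (nbhs (0 : V))) (cvg_cst x)).
  have cfg : \forall h \near (0 : V), f (h + x) = g (h + x).
    exact: (c [set y | f y = g y] fg).
  by apply: filterS cfg => h e; apply/eqP; rewrite subr_eq0 e.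
have E : (g - f) \o shift x = cst ((g - f) x) + \0 +o_ (0:V) id.
  apply/eqaddoP => _/posnumP[e]; near=> h.
  have gfx : (g - f) x = 0 by move: (nbhs_singleton h0); rewrite /= add0r.
  have -> : ((g - f) \o shift x - (cst ((g - f) x) + \0)) h = 0.
    transitivity ((g - f) (h + x) - ((g - f) x + 0)); first by [].
    rewrite gfx addr0 subr0.
    exact: (near h0 h).
  by rewrite normr0 mulr_ge0.
have c0 : continuous (\0 : {linear V -> W}) by apply: cst_continuous.
by apply/diff_locallyP; rewrite (diff_unique c0 E).
Unshelve. all: by end_near. Qed.

Lemma differentiable_lin_comp V W Z (f : V -> W) (l : {linear W -> Z}) x :
  continuous l -> differentiable f x -> differentiable (l \o f) x.
Proof.
by move=> cl df; apply: differentiable_comp => //; exact: linear_differentiable cl.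
Qed.

Lemma derive_comp_lin V W Z (f : V -> W) (l : {linear W -> Z}) x v :
  continuous l -> differentiable f x -> 'D_v (l \o f) x = l ('D_v f x).
Proof.
move=> cl df; rewrite deriveE ?deriveE //; last exact: differentiable_lin_comp.
rewrite diff_comp //=; last exact: linear_differentiable.
by rewrite diff_lin.
Qed.

Lemma derive_linear V (l : {linear V -> R}) x v :
  continuous l -> 'D_v l x = l v.
Proof. by move=> cl; rewrite deriveE ?diff_lin //; exact: linear_differentiable. Qed.

Lemma near_open V (U : set V) (P : V -> Prop) x :
  open U -> U x -> (forall y, U y -> P y) -> \forall y \near x, P y.
Proof.
move=> oU Ux UP; have := open_nbhs_nbhs (conj oU Ux).
by apply: filterS => y; apply: UP.
Qed.

(** On an open set derivatives depend only on the values there. The closure properties below use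
    this to replace a derivative by an expression that is valid on [U] only. *)
Lemma Cdiff_eq V W p (U : set V) (f g : V -> W) :
  open U -> (forall x, U x -> f x = g x) -> Cdiff p U f -> Cdiff p U g.
Proof.
move=> oU; elim: p f g => [|p IH] f g fg /=.
  move=> cf x Ux; rewrite /prop_for /continuous_at -fg //.
  apply: cvg_trans (cf x Ux); apply: near_eq_cvg.
  by apply: near_open Ux _ => // y /fg.
case=> df Df; split=> [x Ux|v].
  by apply: near_eq_differentiable (df x Ux); apply: near_open Ux _ => // y /fg.
apply: IH (Df v) => x Ux; apply: near_eq_derive.
by apply: near_open Ux _ => // y /fg.
Qed.

Lemma Cdiff_subset V W p (U U' : set V) (f : V -> W) :
  U' `<=` U -> Cdiff p U f -> Cdiff p U' f.
Proof.
move=> sub; elim: p f => [|p IH] f /=; first by move=> h x /sub; apply: h.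
by case=> df Df; split=> [x /sub|v]; [apply: df | apply/IH/Df].
Qed.

Lemma Cdiff_local V W p (U : set V) (f : V -> W) :
  (forall x, U x -> exists U', [/\ open U', U' x & Cdiff p U' f]) ->
  Cdiff p U f.
Proof.
elim: p f => [|p IH] f h /=.
  by move=> x /h [U' [_ Ux cf]]; apply: cf.
split=> [x /h [U' [_ Ux [df _]]]|v]; first exact: df.
by apply: IH => x /h [U' [oU Ux [_ Df]]]; exists U'; split=> //; apply: Df.
Qed.

Lemma CdiffW V W p (U : set V) (f : V -> W) : Cdiff p.+1 U f -> Cdiff p U f.
Proof.
elim: p f => [|p IH] f [df Df]; first by move=> x /df; apply: differentiable_continuous.
by split=> // v; apply/IH/Df.
Qed.

Lemma Cdiff_cst V W p (U : set V) (a : W) : Cdiff p U (fun=> a).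
Proof.
elim: p a => [|p IH] a /=; first by move=> x _; apply: cst_continuous.
split=> [x _|v]; first exact: differentiable_cst.
have -> : (fun x : V => 'D_v (fun=> a) x) = fun=> 0.
  by apply/funext => x; apply: derive_cst.
exact: IH.
Qed.

Lemma CdiffD V W p (U : set V) (f g : V -> W) : open U ->
  Cdiff p U f -> Cdiff p U g -> Cdiff p U (fun x => f x + g x).
Proof.
move=> oU; elim: p f g => [|p IH] f g /=.
  by move=> cf cg x Ux; apply: continuousD; [apply: cf | apply: cg].
move=> [df Df] [dg Dg]; split=> [x Ux|v].
  by apply: differentiableD; [apply: df | apply: dg].
apply: Cdiff_eq (IH _ _ (Df v) (Dg v)) => // x Ux.
by rewrite -deriveD //; apply: diff_derivable; [apply: df | apply: dg].
Qed.

Lemma Cdiff_lin_comp V W Z p (U : set V) (f : V -> W) (l : {linear W -> Z}) :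
  open U -> continuous l -> Cdiff p U f -> Cdiff p U (fun x => l (f x)).
Proof.
move=> oU cl; elim: p f => [|p IH] f /=.
  by move=> cf x Ux; apply: continuous_comp; [apply: cf | apply: cl].
move=> [df Df]; split=> [x Ux|v].
  by apply: differentiable_lin_comp => //; apply: df.
apply: Cdiff_eq (IH _ (Df v)) => // x Ux.
by rewrite -derive_comp_lin //; apply: df.
Qed.

Lemma CdiffM V p (U : set V) (f g : V -> R) : open U ->
  Cdiff p U f -> Cdiff p U g -> Cdiff p U (fun x => f x * g x).
Proof.
move=> oU; elim: p f g => [|p IH] f g /=.
  by move=> cf cg x Ux; apply: continuousM; [apply: cf | apply: cg].
move=> Sf Sg; have [df Df] := Sf; have [dg Dg] := Sg; split=> [x Ux|v].
  by apply: differentiableM; [apply: df | apply: dg].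
(* The Leibniz rule pairs a derivative of one factor with the other factor undifferentiated, whose
   order is lowered to [p] by [CdiffW]. *)
apply: Cdiff_eq (CdiffD oU (IH _ _ (CdiffW Sf) (Dg v)) (IH _ _ (CdiffW Sg) (Df v))) => // x Ux.
by apply/esym/deriveM; apply: diff_derivable; [apply: df | apply: dg].
Qed.

Lemma smooth_eq V W (U : set V) (f g : V -> W) :
  open U -> (forall x, U x -> f x = g x) -> smooth U f -> smooth U g.
Proof. by move=> oU fg sf p; apply: Cdiff_eq (sf p). Qed.

Lemma smooth_subset V W (U U' : set V) (f : V -> W) :
  U' `<=` U -> smooth U f -> smooth U' f.
Proof. by move=> sub sf p; apply: Cdiff_subset (sf p). Qed.

Lemma smooth_local V W (U : set V) (f : V -> W) :
  (forall x, U x -> exists U', [/\ open U', U' x & smooth U' f]) -> smooth U f.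
Proof.
move=> H p; apply: Cdiff_local => x /H [U' [oU' U'x sf]].
by exists U'; split.
Qed.

Lemma smooth_differentiable V W (U : set V) (f : V -> W) x :
  smooth U f -> U x -> differentiable f x.
Proof. by move=> sf; apply: (sf 1).1. Qed.

Lemma smooth_derive V W (U : set V) (f : V -> W) v :
  smooth U f -> smooth U ('D_v f).
Proof. by move=> sf p; apply: (sf p.+1).2. Qed.

Lemma smooth_cst V W (U : set V) (a : W) : smooth U (fun=> a).
Proof. by move=> p; apply: Cdiff_cst. Qed.

Lemma smoothM V (U : set V) (f g : V -> R) : open U ->
  smooth U f -> smooth U g -> smooth U (fun x => f x * g x).
Proof. by move=> oU sf sg p; apply: CdiffM. Qed.

Lemma smooth_lin_comp V W Z (U : set V) (f : V -> W) (l : {linear W -> Z}) :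
  open U -> continuous l -> smooth U f -> smooth U (fun x => l (f x)).
Proof. by move=> oU cl sf p; apply: Cdiff_lin_comp. Qed.

Lemma Cdiff_sum V W p (U : set V) n (f : 'I_n -> V -> W) : open U ->
  (forall i, Cdiff p U (f i)) -> Cdiff p U (fun x => \sum_i f i x).
Proof.
move=> oU; elim: n f => [|n IH] f sf.
  by apply: Cdiff_eq (Cdiff_cst p U (0 : W)) => // x _; rewrite big_ord0.
apply: Cdiff_eq (CdiffD oU (sf ord0) (IH _ (fun i => sf (lift ord0 i)))) => //.
by move=> x _; rewrite big_ord_recl.
Qed.

Lemma smooth_sum V W (U : set V) n (f : 'I_n -> V -> W) : open U ->
  (forall i, smooth U (f i)) -> smooth U (fun x => \sum_i f i x).
Proof. by move=> oU sf p; apply: Cdiff_sum => // i; apply: sf. Qed.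

Lemma Cdiff_scalel V W p (U : set V) (k : V -> R) (a : W) : open U ->
  Cdiff p U k -> Cdiff p U (fun x => k x *: a).
Proof.
move=> oU.
have sx_lin : linear ( *:%R ^~ a : R -> W).
  by move=> u y z; rewrite scalerDl scalerA.
pose sxlM := GRing.isLinear.Build _ _ _ _ _ sx_lin.
pose sxL : {linear R -> W} := HB.pack ( *:%R ^~ a) sxlM.
exact: (@Cdiff_lin_comp V R W p U k sxL oU (@scalel_continuous _ _ a)).
Qed.

End Calculus.

(** A named coordinate function, to which the linear structure can be attached. *)
Definition mx_coord {R : realType} {m n} (i : 'I_m) (j : 'I_n)
  (M : 'M[R]_(m, n)) : R := M i j.

Section MxCoord.
Context {R : realType} {m n : nat} (i : 'I_m) (j : 'I_n).

Let mx_coord_linear : linear (@mx_coord R m n i j).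
Proof. by move=> a u v; rewrite /mx_coord !mxE. Qed.

HB.instance Definition _ :=
  GRing.isLinear.Build R 'M[R]_(m, n) R _ (@mx_coord R m n i j) mx_coord_linear.

Lemma mx_coord_cts : continuous (@mx_coord R m n i j).
Proof. exact: coord_continuous. Qed.
End MxCoord.

(** * Finite-dimensional spaces and the chain rule *)

Section FiniteDimension.
Context {R : realType}.

(* [Cdiff] differentiates along constant vectors only, so the chain rule has to
   expand the varying direction ['D_v g x] in a basis. *)
Class findim (V : normedModType R) := Findim {
  fdim : nat;
  fbasis : 'I_fdim -> V;
  fcoord : 'I_fdim -> {linear V -> R};
  fcoord_continuous : forall i, continuous (fcoord i);
  fcoordE : forall v, v = \sum_i fcoord i v *: fbasis i }.

#[global] Instance findim_rV n : findim 'rV[R]_n :=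
  @Findim 'rV[R]_n n (fun i => delta_mx 0 i) (fun i => mx_coord 0 i)
    (fun i => @mx_coord_cts R 1 n 0 i) (@row_sum_delta R n).

#[global] Instance findim_real : findim (R : normedModType R).
Proof.
apply: (@Findim R 1 (fun=> 1) (fun=> idfun)); first by move=> i x; apply: cvg_id.
by move=> v; rewrite big_ord1 [LHS](esym (mulr1 v)).
Defined.

Section Product.
Context {V W : normedModType R} {fV : findim V} {fW : findim W}.

(** Indexed by the disjoint union of the two index sets; [fintype.split] later transports this to
    the single ordinal that [findim] asks for. *)
Definition prod_basis (s : 'I_(@fdim V fV) + 'I_(@fdim W fW)) : V * W :=
  match s with inl j => (fbasis j, 0) | inr j => (0, fbasis j) end.

Definition prod_coord (s : 'I_(@fdim V fV) + 'I_(@fdim W fW)) :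
    {linear (V * W)%type -> R} :=
  match s with inl j => fcoord j \o fst | inr j => fcoord j \o snd end.

Lemma prod_coord_continuous s : continuous (prod_coord s).
Proof.
case: s => j x.
  by apply: continuous_comp; [exact: cvg_fst | exact: fcoord_continuous].
by apply: continuous_comp; [exact: cvg_snd | exact: fcoord_continuous].
Qed.

Lemma prod_coordE (v : V * W) :
  v = \sum_i prod_coord (fintype.split i) v *: prod_basis (fintype.split i).
Proof.
rewrite big_split_ord /=; case: v => v w.
transitivity ((v, 0) + (0, w) : V * W).
  by congr (_, _); rewrite ?addr0 ?add0r.
congr (_ + _).
  transitivity (\sum_i (fcoord i v *: fbasis i, 0 : W)); last first.
    apply: eq_bigr => i _; rewrite (_ : fintype.split _ = inl i) /=; last first.
      exact: (unsplitK (inl i)).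
    by congr (_, _); rewrite scaler0.
  rewrite {1}[v]fcoordE; elim/big_rec2: _ => // i x y _ <-.
  by congr (_, _); rewrite addr0.
transitivity (\sum_i (0 : V, fcoord i w *: fbasis i)); last first.
  apply: eq_bigr => i _; rewrite (_ : fintype.split _ = inr i) /=; last first.
    exact: (unsplitK (inr i)).
  by congr (_, _); rewrite scaler0.
rewrite {1}[w]fcoordE; elim/big_rec2: _ => // i x y _ <-.
by congr (_, _); rewrite addr0.
Qed.

#[global] Instance findim_prod : findim (V * W)%type :=
  @Findim (V * W)%type _ _ _ (fun i => @prod_coord_continuous (fintype.split i))
    prod_coordE.

End Product.

Implicit Types (V W Z : normedModType R).

(** By [fcoordE], [f] is a sum of scalar coordinates times constant basis vectors, so regularity can
    be tested on the coordinates. *)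
Lemma Cdiff_fcoord V W {fW : findim W} p (U : set V) (f : V -> W) : open U ->
  (forall i, Cdiff p U (fun x => fcoord i (f x))) -> Cdiff p U f.
Proof.
move=> oU cf; have := Cdiff_sum oU (fun i => Cdiff_scalel (fbasis i) oU (cf i)).
by apply: Cdiff_eq => // x _; rewrite -fcoordE.
Qed.

Lemma derive_basis V W {fV : findim V} (f : V -> W) x v : differentiable f x ->
  'D_v f x = \sum_i fcoord i v *: 'D_(fbasis i) f x.
Proof.
move=> df; rewrite deriveE // {1}[v]fcoordE linear_sum; apply: eq_bigr => i _.
by rewrite linearZ deriveE.
Qed.

Lemma derive_compE V W Z (f : W -> Z) (g : V -> W) x v :
  differentiable g x -> differentiable f (g x) ->
  'D_v (fun y => f (g y)) x = 'D_('D_v g x) f (g x).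
Proof.
move=> dg df; rewrite deriveE; last exact: differentiable_comp.
by rewrite [in LHS]diff_comp //= !deriveE.
Qed.

(** Induction on the order. By the chain rule, each coordinate of the derivative is a sum of
    products of a coordinate of ['D_v g x] with a coordinate of ['D_(fbasis i) f (g x)]; the
    direction in the second factor is constant, so the induction hypothesis applies to it. *)
Lemma Cdiff_comp V W Z {fW : findim W} {fZ : findim Z} p (U : set V) (U' : set W)
    (f : W -> Z) (g : V -> W) : open U -> (forall x, U x -> U' (g x)) ->
  Cdiff p U' f -> Cdiff p U g -> Cdiff p U (fun x => f (g x)).
Proof.
move=> oU UU'; elim: p f => [|p IH] f.
  move=> /= cf cg x Ux.
  by apply: continuous_comp; [apply: cg | apply/cf/UU'].
move=> Sf Sg; have [df Df] := Sf; have [dg Dg] := Sg; split=> [x Ux|v].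
  by apply: differentiable_comp; [apply: dg | apply/df/UU'].
apply: Cdiff_fcoord => // j.
have H i : Cdiff p U (fun x => fcoord i ('D_v g x) * fcoord j ('D_(fbasis i) f (g x))).
  apply: CdiffM => //.
    by apply: Cdiff_lin_comp (Dg v) => //; exact: fcoord_continuous.
  apply: Cdiff_lin_comp => //; first exact: fcoord_continuous.
  exact: (IH ('D_(fbasis i) f) (Df _) (CdiffW Sg)).
apply: Cdiff_eq (Cdiff_sum oU H) => // x Ux.
have dfx := df _ (UU' _ Ux).
rewrite [in RHS](derive_compE v (dg _ Ux) dfx).
rewrite [in RHS](derive_basis _ dfx) linear_sum; apply: eq_bigr => i _.
by rewrite linearZ.
Qed.

Lemma smooth_comp V W Z {fW : findim W} {fZ : findim Z} (U : set V) (U' : set W)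
    (f : W -> Z) (g : V -> W) : open U -> (forall x, U x -> U' (g x)) ->
  smooth U' f -> smooth U g -> smooth U (fun x => f (g x)).
Proof. by move=> oU UU' sf sg p; apply: Cdiff_comp (sf p) (sg p). Qed.

Lemma smooth_fcoord V W {fW : findim W} (U : set V) (f : V -> W) : open U ->
  (forall i, smooth U (fun x => fcoord i (f x))) -> smooth U f.
Proof. by move=> oU sf p; apply: Cdiff_fcoord => // i; apply: sf. Qed.

Lemma smooth_scale V W {fW : findim W} (U : set V) (k : V -> R) (f : V -> W) :
  open U -> smooth U k -> smooth U f -> smooth U (fun x => k x *: f x).
Proof.
move=> oU sk sf; apply: smooth_fcoord => // i.
have := smoothM oU sk (smooth_lin_comp oU (@fcoord_continuous _ _ i) sf).
by apply: smooth_eq => // x _; rewrite linearZ.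
Qed.

Lemma smooth_pair V W Z {fW : findim W} {fZ : findim Z} (U : set V)
    (f : V -> W) (g : V -> Z) : open U ->
  smooth U f -> smooth U g -> smooth U (fun x => (f x, g x)).
Proof.
move=> oU sf sg; apply: smooth_fcoord => // i /=.
rewrite /fcoord /=; case: (fintype.split i) => j /=.
  by apply: smooth_lin_comp => //; exact: fcoord_continuous.
by apply: smooth_lin_comp => //; exact: fcoord_continuous.
Qed.

Lemma smooth_id V (U : set V) : smooth U id.
Proof.
case=> [|p] /=; first by move=> x _; apply: cvg_id.
split=> [x _|v]; first by [].
have -> : (fun x : V => 'D_v id x) = fun=> v.
  by apply/funext => x; apply: derive_id.
exact: Cdiff_cst.
Qed.

(** Expanding the varying direction in the fixed basis leaves smooth coefficients times derivatives
    in constant directions. *)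
Lemma smooth_derive_along V W {fV : findim V} {fW : findim W} (U : set V)
    (f : V -> W) (h : V -> V) : open U ->
  smooth U f -> smooth U h -> smooth U (fun x => 'D_(h x) f x).
Proof.
move=> oU sf sh.
have H i : smooth U (fun x => fcoord i (h x) *: 'D_(fbasis i) f x).
  apply: smooth_scale => //; last exact: smooth_derive.
  by apply: smooth_lin_comp => //; exact: fcoord_continuous.
apply: smooth_eq (smooth_sum oU H) => // x Ux.
by rewrite -derive_basis //; apply: smooth_differentiable Ux.
Qed.

End FiniteDimension.

(** * Directional derivatives and tangency *)

Section DirectionalDerivatives.
Context {R : realType}.
Implicit Types (V W : normedModType R).

Lemma derive_sub_sum V n (F : V -> R) (G : 'I_n -> V -> R) x v :
  differentiable F x -> (forall a, differentiable (G a) x) ->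
  'D_v (fun y => F y - \sum_a G a y) x = 'D_v F x - \sum_a 'D_v (G a) x.
Proof.
move=> dF dG.
have dS a : derivable (G a) x v by apply/diff_derivable.
have -> : (fun y => F y - \sum_a G a y) = F - \sum_a G a.
  by apply/funext => y; rewrite -[RHS]/(F y - _) fct_sumE.
rewrite deriveB ?derive_sum //; first exact: diff_derivable.
exact: derivable_sum.
Qed.

Lemma differentiable_sub_sum V n (F : V -> R) (G : 'I_n -> V -> R) x :
  differentiable F x -> (forall a, differentiable (G a) x) ->
  differentiable (fun y => F y - \sum_a G a y) x.
Proof.
move=> dF dG.
have -> : (fun y => F y - \sum_a G a y) = F - \sum_a G a.
  by apply/funext => y; rewrite -[RHS]/(F y - _) fct_sumE.
by apply: differentiableB => //; apply: differentiable_sum.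
Qed.

Lemma derive_mul V (f g : V -> R) x v :
  differentiable f x -> differentiable g x ->
  'D_v (fun y => f y * g y) x = 'D_v f x * g x + f x * 'D_v g x.
Proof.
move=> df dg; rewrite [LHS](@deriveM _ _ f g); [|exact: diff_derivable..].
by rewrite [LHS]addrC; congr (_ + _); exact: mulrC.
Qed.

Lemma derive_add V (f g : V -> R) x v :
  differentiable f x -> differentiable g x ->
  'D_v (fun y => f y + g y) x = 'D_v f x + 'D_v g x.
Proof.
by move=> df dg; rewrite [LHS](@deriveD _ _ _ f g); [|exact: diff_derivable..].
Qed.

(** [F] is identically zero along a curve in [S] with velocity [v], and the chain rule identifies
    the derivative of the composite at time 0 with ['D_v F x]. All later uses of tangency go through
    this lemma. *)
Lemma derive_tangent V (S : set V) x v (F : V -> R) :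
  tangent_to S x v -> (forall y, S y -> F y = 0) -> differentiable F x ->
  'D_v F x = 0.
Proof.
move=> [e [c [e0 sc c0 dc cS]]] F0 dF.
have I0 : `]-e, e[%classic (0 : R) by rewrite /= in_itv /= oppr_lt0 e0.
have dc0 : differentiable c 0 := smooth_differentiable sc I0.
have -> : 'D_v F x = 'D_1 (fun t => F (c t)) 0.
  by rewrite (@derive_compE _ _ _ _ F c) ?c0 // -dc derive1E.
transitivity ('D_(1 : R) (cst (0 : R)) (0 : R)); last exact: derive_cst.
apply: near_eq_derive.
apply: (near_open (U := `]-e, e[%classic)) => // t.
by rewrite /= in_itv /= => /cS/F0.
Qed.

(** Each component of [z.2 - F z.1] vanishes on [S], so its derivative along [(g, A)], which is that
    component of [A - 'D_g F x], is zero. *)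
Lemma tangent_graph V k
    (S : set (V * 'rV[R]_k)) (F : V -> 'rV[R]_k) x mu g A :
  tangent_to S (x, mu) (g, A) -> (forall z, S z -> z.2 = F z.1) ->
  differentiable F x -> A = 'D_g F x.
Proof.
move=> tS SF dF; apply/rowP => a; apply/eqP; rewrite -subr_eq0; apply/eqP.
pose co : {linear 'rV[R]_k -> R} := mx_coord 0 a.
have cco : continuous co by exact: mx_coord_cts.
pose cs : {linear (V * 'rV[R]_k)%type -> R} := co \o snd.
have ccs : continuous cs.
  by move=> y; apply: continuous_comp; [exact: cvg_snd | exact: cco].
pose G (z : V * 'rV[R]_k) : R := (co \o F) z.1.
have dG : differentiable G (x, mu).
  apply: (@differentiable_comp _ _ _ _ (@fst V 'rV[R]_k) (co \o F)).
    by apply: linear_differentiable => y; exact: cvg_fst.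
  exact: differentiable_lin_comp.
have dcs : differentiable cs (x, mu) by exact: linear_differentiable.
have <- : 'D_(g, A) (fun z => cs z - G z) (x, mu) = 0.
  apply: (derive_tangent tS); last exact: differentiableB.
  by move=> z /SF zE; rewrite /G /= zE subrr.
rewrite [RHS](@deriveB _ _ _ cs G); [|exact: diff_derivable..].
rewrite derive_linear //; congr (_ - _).
(* [G] depends on the first factor only, so its difference quotients along [(g, A)] are by
   computation those of [co \o F] along [g]. *)
by rewrite [RHS](_ : _ = 'D_g (co \o F) x) // derive_comp_lin.
Qed.

Lemma open_smooth_preimage V W (U : set V) (U' : set W) (f : V -> W) :
  open U -> open U' -> smooth U f -> open (U `&` f @^-1` U').
Proof.
move=> oU oU' sf; rewrite openE => x [Ux U'fx].
apply: filterI; first exact: open_nbhs_nbhs.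
apply: (sf 0 x Ux); exact: open_nbhs_nbhs.
Qed.

End DirectionalDerivatives.

(** * Vertical lifts and the pairing with covectors *)

Definition vertical {R : realType} {n} (u : 'rV[R]_n) : vel_space R n := (0, u).

Section Vertical.
Context {R : realType} {n : nat}.

Let vertical_linear : linear (@vertical R n).
Proof. by move=> a u v; rewrite /vertical; congr (_, _); rewrite /= scaler0 addr0. Qed.

HB.instance Definition _ :=
  GRing.isLinear.Build R 'rV[R]_n (vel_space R n) _ (@vertical R n) vertical_linear.

End Vertical.

Section Pairing.
Context {R : realType} {m k : nat}.
Implicit Types (p : 'cV[R]_(m + k)).

Let pairing_linear p : linear (pairing p).
Proof. by move=> a u v; rewrite /pairing mulmxDl -scalemxAl !mxE. Qed.

HB.instance Definition _ p :=
  GRing.isLinear.Build R 'rV[R]_(m + k) R _ (pairing p) (@pairing_linear p).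

Lemma smooth_pairing (V : normedModType R) (U : set V)
    (f : V -> 'cV[R]_(m + k)) (g : V -> 'rV[R]_(m + k)) : open U ->
  (forall j, smooth U (fun y => f y j 0)) -> smooth U g ->
  smooth U (fun y => pairing (f y) (g y)).
Proof.
move=> oU sf sg.
have H j : smooth U (fun y => mx_coord 0 j (g y) * f y j 0).
  by apply: smoothM => //; apply: smooth_lin_comp => //; apply: mx_coord_cts.
by apply: smooth_eq (smooth_sum oU H) => // y _; rewrite /pairing mxE.
Qed.

Lemma pairing_continuous p : continuous (pairing p).
Proof.
move=> u; have sp j := smooth_cst [set: 'rV[R]_(m + k)] (p j 0).
(* The last argument selects order 0 of smoothness, which is continuity. *)
exact: (smooth_pairing (f := fun=> p) openT sp (@smooth_id _ _ setT) 0).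
Qed.

End Pairing.

(** * Euler-Lagrange and vakonomic equations *)

Section FibreDerivative.
Context {R : realType} {m k : nat}.
Local Notation n := (m + k)%N.
Local Notation base := 'rV[R]_n.
Local Notation TB := (vel_space R n).
Variables (Q : set base) (X : 'I_n -> base -> base).
Variable theta : 'I_n -> base -> 'cV[R]_n.
Hypothesis openQ : open Q.
Hypothesis coframe : dual_coframe Q X theta.

Local Notation TQ := (tangent_bundle Q).
Local Notation form i z := (fun y : TB => pairing (theta i y.1) z).
Local Notation vel i := (quasi_velocity theta i).

Lemma open_TQ : open TQ.
Proof. by apply: open_comp openQ => w _; exact: cvg_fst. Qed.

Lemma smooth_fst (U : set TB) : open U -> smooth U (@fst base base).
Proof.
by move=> oU; apply: (smooth_lin_comp (l := fst)) (smooth_id _) => // x; apply: cvg_fst.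
Qed.

Lemma smooth_snd (U : set TB) : open U -> smooth U (@snd base base).
Proof.
by move=> oU; apply: (smooth_lin_comp (l := snd)) (smooth_id _) => // x; apply: cvg_snd.
Qed.

Lemma smooth_base (W : normedModType R) {fW : findim W} (f : base -> W) :
  smooth Q f -> smooth TQ (fun y => f y.1).
Proof.
move=> sf; apply: (smooth_comp (U' := Q)) => //; first exact: open_TQ.
exact/smooth_fst/open_TQ.
Qed.

Lemma smooth_theta i (W : set TB) (g : TB -> base) : open W -> W `<=` TQ ->
  smooth W g -> smooth W (fun y => pairing (theta i y.1) (g y)).
Proof.
move=> oW sub sg.
apply: smooth_pairing => // j; apply: smooth_subset sub _.
apply: (smooth_base (f := fun q => mx_coord j 0 (theta i q))).
by apply: smooth_lin_comp (coframe.1 i) => //; apply: mx_coord_cts.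
Qed.

Lemma smooth_form i z : smooth TQ (form i z).
Proof. exact: (smooth_theta i open_TQ (@subset_refl _ _) (smooth_cst _ _)). Qed.

Lemma smooth_vel i : smooth TQ (vel i).
Proof. exact: (smooth_theta i open_TQ (@subset_refl _ _) (smooth_snd open_TQ)). Qed.

(** Duality says that the frame matrix [A] times the coframe matrix [B] is the identity. Both are
    square, so [B *m A] is the identity too, and this is the expansion. *)
Lemma frame_expand q u : Q q -> u = \sum_i pairing (theta i q) u *: X i q.
Proof.
move=> Qq.
pose A := \matrix_(i < n) X i q; pose B := \matrix_(j < n, i < n) theta i q j 0.
have AB : A *m B = 1%:M.
  apply/matrixP => i j; rewrite !mxE eq_sym -(coframe.2 _ Qq j i) /pairing !mxE.
  by apply: eq_bigr => l _; rewrite !mxE.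
rewrite -{1}[u]mulmx1 -(mulmx1C AB) mulmxA mulmx_sum_row.
apply: eq_bigr => i _; rewrite rowK; congr (_ *: _).
by rewrite /pairing !mxE; apply: eq_bigr => l _; rewrite !mxE.
Qed.

(** Linearity of the differential collects the frame expansion of [z.1] into one fibre derivative,
    in which the frame no longer appears. *)
Lemma cartan_formE (F : TB -> R) y z : Q y.1 -> differentiable F y ->
  cartan_form X theta F y z = 'D_(vertical z.1) F y.
Proof.
move=> Qy dF; rewrite deriveE // {1}(frame_expand z.1 Qy) !linear_sum.
apply: eq_bigr => i _.
by rewrite !linearZ /vlift deriveE // mulrC.
Qed.

(** The quasi-velocities are the coframe components of [y.2], so the sum in the energy is the Cartan
    form on a vector projecting to [y.2]. *)
Lemma energyE (F : TB -> R) y : Q y.1 -> differentiable F y ->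
  energy X theta F y = 'D_(vertical y.2) F y - F y.
Proof.
move=> Qy dF; rewrite -(@cartan_formE F y (y.2, 0)) //; congr (_ - _).
by apply: eq_bigr => i _; rewrite mulrC.
Qed.

(** Along a fibre the quasi-velocity is a linear form, which is its own derivative. *)
Lemma derive_vertical_vel i u y :
  'D_(vertical u) (vel i) y = form i u y.
Proof.
transitivity ('D_u (pairing (theta i y.1)) y.2).
  rewrite /derive; set F := (fun _ : R => _); set G := (fun _ : R => _).
  suff -> : F = G by [].
  rewrite funeqE => h; rewrite /F /G /quasi_velocity /=.
  by rewrite scaler0 add0r.
rewrite deriveE ?diff_lin //; first exact: pairing_continuous.
exact/linear_differentiable/pairing_continuous.
Qed.

Lemma differentiable_form i z y : Q y.1 -> differentiable (form i z) y.
Proof. by move=> Qy; apply: smooth_differentiable (smooth_form i z) _. Qed.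

Lemma differentiable_vel i y : Q y.1 -> differentiable (vel i) y.
Proof. by move=> Qy; apply: smooth_differentiable (smooth_vel i) _. Qed.

Lemma differentiable_derive (W : set TB) (F : TB -> R) v y :
  smooth W F -> W y -> differentiable ('D_v F) y.
Proof. by move=> sF; apply: smooth_differentiable; apply: smooth_derive. Qed.

Lemma smooth_vertical_along (W : set TB) (F : TB -> R) : open W ->
  smooth W F -> smooth W (fun y => 'D_(vertical y.2) F y).
Proof.
move=> oW sF.
have sv : smooth W (fun y : TB => (0 : base, y.2)).
  exact: smooth_pair oW (smooth_cst _ _) (smooth_snd oW).
exact: smooth_derive_along oW sF sv.
Qed.

End FibreDerivative.

(** * Comparison of the Euler-Lagrange and vakonomic equations *)

Section Equations.
Context {R : realType} {m k : nat}.
Local Notation n := (m + k)%N.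
Local Notation base := 'rV[R]_n.
Local Notation TB := (vel_space R n).
Local Notation TBM := (vel_space R n * 'rV[R]_k)%type.
Variables (Q : set base) (X : 'I_n -> base -> base).
Variable theta : 'I_n -> base -> 'cV[R]_n.
Hypothesis openQ : open Q.
Hypothesis coframe : dual_coframe Q X theta.

Local Notation TQ := (tangent_bundle Q).
Local Notation form i z := (fun y : TB => pairing (theta i y.1) z).
Local Notation vel i := (quasi_velocity theta i).
Local Notation normal a := (rshift m a).

Lemma smooth_cartan_form (W : set TB) (F : TB -> R) z :
  open W -> W `<=` TQ -> smooth W F ->
  smooth W (fun y => cartan_form X theta F y z).
Proof.
move=> oW sub sF; apply: smooth_eq (smooth_derive (vertical z.1) sF) => // y Wy.
rewrite (cartan_formE coframe) //; first exact: sub.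
exact: smooth_differentiable Wy.
Qed.

(** The differential of [mu_a theta^a] is [dmu_a /\ theta^a + mu_a dtheta^a]; the wedge product
    gives the terms in [A] and [nu]. *)
Lemma vak_ext_d (L : TB -> R) x mu g A w nu : smooth TQ L -> Q x.1 ->
  ext_d (vak_form X theta L) (x, mu) (g, A) (w, nu) =
  ext_d (cartan_form X theta L) x g w
  - \sum_a (A 0 a * form (normal a) w.1 x
            + mu 0 a * ext_d (fun y z => form (normal a) z.1 y) x g w
            - nu 0 a * form (normal a) g.1 x).
Proof.
move=> sL Qx.
have dfst (F : TB -> R) : differentiable F x ->
    differentiable (fun z : TBM => F z.1) (x, mu).
  move=> dF; apply: (@differentiable_comp _ _ _ _ (@fst TB 'rV[R]_k)) => //.
  by apply: linear_differentiable => y; apply: cvg_fst.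
pose co a : {linear TBM -> R} := mx_coord 0 a \o @snd TB 'rV[R]_k.
have cco a : continuous (co a).
  move=> y; apply: (@continuous_comp _ _ _ (@snd TB 'rV[R]_k)); first exact: cvg_snd.
  exact: mx_coord_cts.
have H (v u : TBM) : 'D_v (fun z => vak_form X theta L z u) (x, mu) =
    'D_(v.1) (fun y => cartan_form X theta L y u.1) x
    - \sum_a (v.2 0 a * form (normal a) u.1.1 x
              + mu 0 a * 'D_(v.1) (form (normal a) u.1.1) x).
  rewrite (@derive_sub_sum _ _ _ (fun z : TBM => cartan_form X theta L z.1 u.1)
    (fun a z => co a z * form (normal a) u.1.1 z.1)).
  - congr (_ - _); apply: eq_bigr => a _.
    rewrite (@derive_mul _ _ (co a) (fun z : TBM => form (normal a) u.1.1 z.1)).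
    + by rewrite derive_linear.
    + by apply: linear_differentiable.
    + exact/(dfst (form _ _))/(differentiable_form openQ coframe).
  - apply: (dfst (fun y => cartan_form X theta L y u.1)).
    apply: smooth_differentiable Qx.
    exact: (smooth_cartan_form _ (open_TQ openQ)).
  - move=> a; apply: differentiableM; first exact: linear_differentiable.
    exact/(dfst (form _ _))/(differentiable_form openQ coframe).
rewrite {1}/ext_d !H /= /ext_d.
have subACA (a b c d : R) : a - c - (b - d) = a - b - (c - d) by ring.
by rewrite subACA -sumrB; congr (_ - _); apply: eq_bigr => a _; ring.
Qed.

Lemma smooth_mx_coord (W : set TB) (Phi : TB -> 'rV[R]_k) a :
  open W -> smooth W Phi -> smooth W (fun y => Phi y 0 a).
Proof.
move=> oW sP.
exact: (smooth_lin_comp (l := mx_coord 0 a) oW (@mx_coord_cts _ _ _ 0 a) sP).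
Qed.

Section Modified.
Variables (L : TB -> R) (N : set TB) (Phi : TB -> 'rV[R]_k).
Hypothesis smoothL : smooth TQ L.
Hypothesis openN : open N.
Hypothesis NTQ : N `<=` TQ.
Hypothesis smoothPhi : smooth N Phi.

Local Notation Lt := (modified_lagrangian theta L Phi).
Local Notation Phi_ a := (fun y : TB => Phi y 0 a).

Let sPhi a : smooth N (Phi_ a) := smooth_mx_coord a openN smoothPhi.
Let sL : smooth N L := smooth_subset NTQ smoothL.
Let svel i : smooth N (vel i) := smooth_subset NTQ (smooth_vel openQ coframe i).
Let sform i z : smooth N (form i z) :=
  smooth_subset NTQ (smooth_form openQ coframe i z).

Lemma derive_modified v y : N y ->
  'D_v Lt y = 'D_v L y - \sum_a ('D_v (Phi_ a) y * vel (normal a) y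
                                + Phi y 0 a * 'D_v (vel (normal a)) y).
Proof.
move=> Ny.
have dP a := smooth_differentiable (sPhi a) Ny.
have dv i := smooth_differentiable (svel i) Ny.
rewrite [LHS](@derive_sub_sum _ _ _ L (fun a z => Phi z 0 a * vel (normal a) z)).
- congr (_ - _); apply: eq_bigr => a _.
  by rewrite (@derive_mul _ _ (Phi_ a) (vel (normal a))).
- exact: smooth_differentiable Ny.
- by move=> a; apply: differentiableM.
Qed.

Lemma differentiable_modified y : N y -> differentiable Lt y.
Proof.
move=> Ny; apply: differentiable_sub_sum; first exact: smooth_differentiable Ny.
move=> a; apply: differentiableM; first exact: smooth_differentiable (sPhi a) Ny.
exact: smooth_differentiable (svel _) Ny.
Qed.

(** The Cartan form of [Lt] on [z] is that of [L] minus the sum of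
    [(z.1)^V(Phi_a) v^a + Phi_a theta^a(z.1)]. In its exterior derivative at [x], the three
    hypotheses on [v^a], [dv^a(g)] and [theta^a(g.1)] remove the second derivatives of [Phi_a], the
    terms in [(w.1)^V(Phi_a)] and those in [dPhi_a(w)], respectively. *)
Lemma ext_d_modified x g w : N x ->
  (forall a, vel (normal a) x = 0) ->
  (forall a, 'D_g (vel (normal a)) x = 0) ->
  (forall a, form (normal a) g.1 x = 0) ->
  ext_d (cartan_form X theta Lt) x g w =
  ext_d (cartan_form X theta L) x g w
  - \sum_a ('D_g (Phi_ a) x * form (normal a) w.1 x
            + Phi x 0 a * ext_d (fun y z => form (normal a) z.1 y) x g w
            - 'D_(vertical g.1) (Phi_ a) x * 'D_w (vel (normal a)) x).
Proof.
move=> Nx vx vg fg.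
have near_form z : \forall y \near x, cartan_form X theta Lt y z =
    cartan_form X theta L y z
    - \sum_a ('D_(vertical z.1) (Phi_ a) y * vel (normal a) y
              + Phi y 0 a * form (normal a) z.1 y).
  apply: near_open Nx _ => // y Ny; have Qy := NTQ Ny.
  rewrite !(cartan_formE coframe) //; last 2 first.
  - exact: smooth_differentiable Ny.
  - exact: differentiable_modified.
  rewrite derive_modified //; congr (_ - _); apply: eq_bigr => a _.
  by rewrite derive_vertical_vel.
have H v z : 'D_v (fun y => cartan_form X theta Lt y z) x =
    'D_v (fun y => cartan_form X theta L y z) x
    - \sum_a ('D_(vertical z.1) (Phi_ a) x * 'D_v (vel (normal a)) x
              + ('D_v (Phi_ a) x * form (normal a) z.1 x
                 + Phi x 0 a * 'D_v (form (normal a) z.1) x)).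
  have dP a := smooth_differentiable (sPhi a) Nx.
  have dv i := smooth_differentiable (svel i) Nx.
  have df i := smooth_differentiable (sform i z.1) Nx.
  have dDP a := differentiable_derive (vertical z.1) (sPhi a) Nx.
  rewrite (near_eq_derive _ (near_form z)).
  rewrite (@derive_sub_sum _ _ _ (fun y => cartan_form X theta L y z)
   (fun a y => 'D_(vertical z.1) (Phi_ a) y * vel (normal a) y
                + Phi y 0 a * form (normal a) z.1 y)).
  - congr (_ - _); apply: eq_bigr => a _.
    rewrite (@derive_add _ _ (fun y => 'D_(vertical z.1) (Phi_ a) y * vel (normal a) y)
       (fun y => Phi y 0 a * form (normal a) z.1 y)).
    + rewrite (@derive_mul _ _ (Phi_ a) (form (normal a) z.1)) //.
      rewrite (@derive_mul _ _ ('D_(vertical z.1) (Phi_ a)) (vel (normal a))) //.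
      (* The second derivative of [Phi_a] comes with the factor [v^a], which is zero at [x]. *)
      by rewrite vx mulr0 add0r.
    + exact: differentiableM.
    + exact: differentiableM.
  - by apply: smooth_differentiable Nx; exact: smooth_cartan_form.
  - by move=> a; apply: differentiableD; apply: differentiableM.
rewrite {1}/ext_d !H /ext_d.
have subACA (a b c d : R) : a - c - (b - d) = a - b - (c - d) by ring.
rewrite subACA -sumrB; congr (_ - _); apply: eq_bigr => a _.
(* The two literal zeros stand for [dv^a(g)] and [theta^a(g.1)]. *)
have regroup (c0 c1 c2 c3 c4 c5 c6 c7 c8 : R) : c0 * 0 + (c1 * c2 + c3 * c4) -
    (c5 * c6 + (c7 * 0 + c3 * c8)) = c1 * c2 + c3 * (c4 - c8) - c5 * c6 by ring.
rewrite vg fg; exact: regroup.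
Qed.

(** Since [v^a] is linear on fibres, [u^V(v^a) = v^a], and the terms [Phi_a v^a] cancel in the
    energy of [Lt]. It differs from the energy of [L] only by [u^V(Phi_a) v^a], of which just the
    derivative of [v^a] survives where [v^a = 0]. *)
Lemma derive_energy_modified x w : N x ->
  (forall a, vel (normal a) x = 0) ->
  'D_w (energy X theta Lt) x = 'D_w (energy X theta L) x
  - \sum_a 'D_(vertical x.2) (Phi_ a) x * 'D_w (vel (normal a)) x.
Proof.
move=> Nx vx.
have near_energy : \forall y \near x, energy X theta Lt y =
    energy X theta L y
    - \sum_a 'D_(vertical y.2) (Phi_ a) y * vel (normal a) y.
  apply: near_open Nx _ => // y Ny; have Qy := NTQ Ny.
  rewrite !(energyE coframe) //; last 2 first.
  - exact: smooth_differentiable Ny.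
  - exact: differentiable_modified.
  rewrite derive_modified // /modified_lagrangian.
  rewrite big_split /= (_ : \sum_i Phi y 0 i * 'D_(vertical y.2) (vel (normal i)) y
    = \sum_i Phi y 0 i * vel (normal i) y); first by ring.
  by apply: eq_bigr => a _; rewrite derive_vertical_vel.
have dv i := smooth_differentiable (svel i) Nx.
have dDP a := smooth_differentiable (smooth_vertical_along openN (sPhi a)) Nx.
rewrite (near_eq_derive _ near_energy).
rewrite (@derive_sub_sum _ _ _ (energy X theta L)
   (fun a y => 'D_(vertical y.2) (Phi_ a) y * vel (normal a) y)).
- congr (_ - _); apply: eq_bigr => a _.
  rewrite (@derive_mul _ _ (fun y => 'D_(vertical y.2) (Phi_ a) y) (vel (normal a))) //.
  by rewrite vx mulr0 add0r.
(* The energy of [L] is differentiable because near [x] it is a derivative along a smooth vertical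
   field minus [L]. *)
- apply: (@near_eq_differentiable _ _ _ (fun y => 'D_(vertical y.2) L y - L y)).
    apply: near_open Nx _ => // y Ny.
    rewrite (energyE coframe) //; first exact: NTQ.
    exact: smooth_differentiable Ny.
  apply: differentiableB; last exact: smooth_differentiable Nx.
  exact: smooth_differentiable (smooth_vertical_along openN sL) Nx.
- by move=> a; apply: differentiableM.
Qed.

(** For [g.1 = x.2] the terms in [(g.1)^V(Phi_a)] and [u^V(Phi_a)] cancel, and the [nu] term of the
    vakonomic side vanishes because [theta^a(x.2) = v^a = 0]. The equations then agree for each test
    vector [w], with any [nu]. *)
Lemma EL_vak_equiv x g : N x -> g.1 = x.2 ->
  (forall a, vel (normal a) x = 0) ->
  (forall a, 'D_g (vel (normal a)) x = 0) ->
  hamilton_eq (cartan_form X theta Lt) (energy X theta Lt) x g <->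
  hamilton_eq (vak_form X theta L) (vak_energy X theta L)
    (x, Phi x) (g, 'D_g Phi x).
Proof.
move=> Nx gx vx vg.
have fg a : form (normal a) g.1 x = 0 by rewrite /= gx; apply: vx.
have DPhi a : ('D_g Phi x) 0 a = 'D_g (Phi_ a) x.
  rewrite -[LHS]/(mx_coord 0 a _) -derive_comp_lin //; first exact: mx_coord_cts.
  exact: smooth_differentiable Nx.
have DE w nu : 'D_(w, nu) (vak_energy X theta L) (x, Phi x) =
    'D_w (energy X theta L) x by [].
have E w nu : (ext_d (cartan_form X theta Lt) x g w = - 'D_w (energy X theta Lt) x)
  <-> (ext_d (vak_form X theta L) (x, Phi x) (g, 'D_g Phi x) (w, nu) =
       - 'D_(w, nu) (vak_energy X theta L) (x, Phi x)).
  rewrite DE ext_d_modified // derive_energy_modified // vak_ext_d //; last exact: NTQ.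
  rewrite !sumrB gx.
  have -> : \sum_i nu 0 i * form (normal i) x.2 x = 0.
    by apply: big1 => a _; rewrite [form _ _ _](vx a) mulr0.
  under [in X in _ <-> X]eq_bigr do rewrite DPhi.
  split=> h; lra.
split=> h; first by case=> w nu; exact: (E w nu).1 (h w).
(* Any [nu] would serve here; 0 is taken. *)
by move=> w; exact: (E w 0).2 (h (w, 0)).
Qed.

End Modified.

End Equations.

(** * Second-order property of vakonomic solutions *)

Section SecondOrder.
Context {R : realType} {m k : nat}.
Local Notation n := (m + k)%N.
Local Notation base := 'rV[R]_n.
Local Notation TB := (vel_space R n).
Variables (Q : set base) (X : 'I_n -> base -> base).
Variable theta : 'I_n -> base -> 'cV[R]_n.
Hypothesis openQ : open Q.
Hypothesis coframe : dual_coframe Q X theta.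
Variable L : TB -> R.
Hypothesis smoothL : smooth (tangent_bundle Q) L.

Local Notation TQ := (tangent_bundle Q).

Lemma vertical_expand (u : base) :
  vertical u = \sum_j u 0 j *: vertical (delta_mx 0 j).
Proof.
rewrite {1}[u]row_sum_delta linear_sum; apply: eq_bigr => j _.
by rewrite linearZ.
Qed.

Lemma derive_vertical_expand u y : Q y.1 ->
  'D_(vertical u) L y = \sum_j u 0 j * 'D_(vertical (delta_mx 0 j)) L y.
Proof.
move=> Qy; have dL : differentiable L y := smooth_differentiable smoothL Qy.
rewrite deriveE // {1}vertical_expand linear_sum; apply: eq_bigr => j _.
by rewrite linearZ deriveE.
Qed.

Lemma differentiable_vertical v y : Q y.1 -> differentiable ('D_v L) y.
Proof. by move=> Qy; apply: differentiable_derive smoothL Qy. Qed.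

(** The coordinate expansion of ['D_(vertical u) L] holds near [y] with constant coefficients, so it
    can be differentiated once more. For vertical [v] this produces the fibre Hessian. *)
Lemma derive_vertical_derive v u y : Q y.1 ->
  'D_v ('D_(vertical u) L) y =
  \sum_j u 0 j * 'D_v ('D_(vertical (delta_mx 0 j)) L) y.
Proof.
move=> Qy.
transitivity ('D_v (fun y => \sum_j cst (u 0 j) y * 'D_(vertical (delta_mx 0 j)) L y) y).
  apply: near_eq_derive; apply: (near_open (open_TQ openQ)) Qy _ => z Qz.
  exact: derive_vertical_expand.
have dG j : differentiable (fun y => cst (u 0 j) y * 'D_(vertical (delta_mx 0 j)) L y) y.
  by apply: differentiableM; [exact: differentiable_cst | exact: differentiable_vertical].
rewrite -[in LHS]fct_sumE derive_sum; last by move=> j; exact: diff_derivable.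
apply: eq_bigr => j _.
rewrite (@derive_mul _ _ (cst (u 0 j)) ('D_(vertical (delta_mx 0 j)) L)).
- by rewrite derive_cst mul0r add0r.
- exact: differentiable_cst.
- exact: differentiable_vertical.
Qed.

(** In [u^j dL/du^j - L], differentiating the factors [u^j] along [h] gives the fibre derivative of
    [L], which cancels against that of [- L]; the Hessian applied to the velocity remains. *)
Lemma derive_vertical_energy h y : Q y.1 ->
  'D_(vertical h) (energy X theta L) y =
  \sum_j y.2 0 j * 'D_(vertical h) ('D_(vertical (delta_mx 0 j)) L) y.
Proof.
move=> Qy.
pose co j : {linear TB -> R} := mx_coord 0 j \o @snd base base.
have coE j z : co j z = z.2 0 j by [].
have cco j : continuous (co j).
  move=> z; apply: (@continuous_comp _ _ _ (@snd base base)); first exact: cvg_snd.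
  exact: mx_coord_cts.
have dL z : Q z.1 -> differentiable L z by move=> Qz; exact: smooth_differentiable Qz.
have dco j : differentiable (co j) y by exact: linear_differentiable.
transitivity ('D_(vertical h)
    (fun y => - L y - \sum_j - (co j y * 'D_(vertical (delta_mx 0 j)) L y)) y).
  apply: near_eq_derive; apply: (near_open (open_TQ openQ)) Qy _ => z Qz.
  rewrite (energyE coframe) //; last exact: dL.
  by rewrite derive_vertical_expand // sumrN opprK addrC.
rewrite (@derive_sub_sum _ _ _ (- L)
   (fun j => - (fun y => co j y * 'D_(vertical (delta_mx 0 j)) L y))).
- rewrite deriveN; last exact/diff_derivable/dL.
  rewrite derive_vertical_expand // -opprD -big_split /= -sumrN.
  apply: eq_bigr => j _.
  rewrite deriveN; last first.
    by apply/diff_derivable/differentiableM; [exact: dco | exact: differentiable_vertical].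
  rewrite (@derive_mul _ _ (co j) ('D_(vertical (delta_mx 0 j)) L)) //; last first.
    exact: differentiable_vertical.
  by rewrite derive_linear // !coE /= opprD opprK addKr.
- exact/differentiableN/dL.
- move=> j; apply: differentiableN.
  by apply: differentiableM; [exact: dco | exact: differentiable_vertical].
Qed.

(** On vertical test vectors the multiplier terms disappear and the vakonomic equation says that the
    fibre Hessian annihilates [x.2 - g.1]; regularity makes the Hessian invertible. *)
Lemma vak_second_order x mu g A : regular_lagrangian Q L -> Q x.1 ->
  hamilton_eq (vak_form X theta L) (vak_energy X theta L) (x, mu) (g, A) ->
  g.1 = x.2.
Proof.
move=> regL Qx H; pose H0 := velocity_hessian L x.
have hess i : \sum_j (x.2 - g.1) 0 j * H0 i j = 0.
  pose h : base := delta_mx 0 i.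
  have Hi : ext_d (cartan_form X theta L) x g (vertical h) =
      - 'D_(vertical h) (energy X theta L) x.
    have := H (vertical h, 0).
    rewrite (vak_ext_d openQ coframe) // big1; last first.
      move=> a _; rewrite !mxE mul0r subr0 /=.
      (* [theta^a] is pulled back from the base, where a vertical vector projects to 0: its
         coefficients are constant in that direction, and it vanishes on that vector. *)
      rewrite /ext_d /= [X in _ - X](_ : _ = 0); last first.
        exact: (derive0 (fun q => pairing (theta (rshift m a) q) g.1) x.1).
      rewrite (_ : (fun y : TB => pairing (theta (rshift m a) y.1) 0) = cst 0); last first.
        by apply/funext => y; exact: linear0.
      by rewrite derive_cst [pairing _ 0]linear0 subr0 !mulr0 addr0.
    by rewrite subr0.
  have cf v z : 'D_v (fun y => cartan_form X theta L y z) x =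
      'D_v ('D_(vertical z.1) L) x.
    apply: near_eq_derive; apply: (near_open (open_TQ openQ)) Qx _ => y Qy.
    by rewrite (cartan_formE coframe) //; exact: smooth_differentiable Qy.
  have E1 : 'D_g (fun y => cartan_form X theta L y (vertical h)) x = 0.
    rewrite cf derive_vertical_derive // big1 // => j _.
    by rewrite [_ 0 j]mxE mul0r.
  have E2 : 'D_(vertical h) (fun y => cartan_form X theta L y g) x =
      \sum_j g.1 0 j * H0 i j.
    rewrite cf derive_vertical_derive //; apply: eq_bigr => j _.
    by rewrite [H0 i j]mxE.
  move: Hi; rewrite derive_vertical_energy // /ext_d E1 E2 sub0r => /oppr_inj E.
  transitivity (\sum_j (x.2 0 j * H0 i j - g.1 0 j * H0 i j)).
    by apply: eq_bigr => j _; rewrite [(x.2 - g.1) 0 j]mxE [(- g.1) 0 j]mxE mulrBl.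
  rewrite sumrB; apply/eqP; rewrite subr_eq0 E; apply/eqP/eq_bigr => j _.
  by rewrite [H0 i j]mxE.
(* [hess] sums over the column index of [H0], hence the transpose when velocities are rows. *)
have : (x.2 - g.1) *m H0^T = 0.
  apply/rowP => i; rewrite mxE [RHS]mxE -[RHS](hess i).
  by apply: eq_bigr => j _; rewrite [H0^T j i]mxE.
move/(congr1 (mulmx^~ (invmx H0^T))); rewrite mul0mx mulmxK ?unitmx_tr; last exact: regL.
by move/eqP; rewrite subr_eq0 => /eqP.
Qed.

End SecondOrder.

(** * Retraction onto the constraint and extension of fields *)

Section Retraction.
Context {R : realType} {m k : nat}.
Local Notation n := (m + k)%N.
Local Notation base := 'rV[R]_n.
Local Notation TB := (vel_space R n).
Variables (Q : set base) (D : base -> set base) (X : 'I_n -> base -> base).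
Variable theta : 'I_n -> base -> 'cV[R]_n.
Hypothesis openQ : open Q.
Hypothesis frameX : adapted_frame Q D X.
Hypothesis coframe : dual_coframe Q X theta.

Local Notation TQ := (tangent_bundle Q).
Local Notation C := (constraint Q D).
Local Notation vel i := (quasi_velocity theta i).

(* Composing with this smooth retraction of TQ onto C extends fields given along
   C to all of TQ at once, without a partition of unity. *)
Definition retraction (w : TB) : TB :=
  (w.1, \sum_(al < m) vel (lshift k al) w *: X (lshift k al) w.1).

Lemma smooth_retraction : smooth TQ retraction.
Proof.
have oTQ := open_TQ openQ.
have [sX _ _] := frameX.
apply: smooth_pair => //; first exact: smooth_fst.
apply: smooth_sum => // al; apply: smooth_scale => //.
  exact: (smooth_vel openQ coframe).
exact: (smooth_base openQ (sX _)).
Qed.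

Lemma retraction_constraint w : TQ w -> C (retraction w).
Proof.
move=> Qw; split=> //; have [_ _ /(_ _ Qw) DX] := frameX.
by apply/DX; exists (\row_al vel (lshift k al) w); apply: eq_bigr => al _; rewrite mxE.
Qed.

(** Vectors of [D] are combinations of the first [m] frame fields, which the last [k] covectors
    annihilate by duality. *)
Lemma constraint_vel_eq0 w a : C w -> vel (rshift m a) w = 0.
Proof.
move=> [Qw Dw]; have [_ _ /(_ _ Qw) DX] := frameX.
have [c cE] := (DX w.2).1 Dw.
rewrite /quasi_velocity cE linear_sum big1 // => al _.
by rewrite linearZ /= (coframe.2 _ Qw) eq_rlshift scaler0.
Qed.

Lemma retraction_id w : C w -> retraction w = w.
Proof.
move=> Cw; have [Qw _] := Cw; rewrite /retraction [RHS]surjective_pairing.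
congr (_, _); rewrite [RHS](frame_expand coframe w.2 Qw) big_split_ord /=.
rewrite [X in _ = _ + X]big1 ?addr0 // => a _.
by rewrite -/(vel (rshift m a) w) constraint_vel_eq0 // scale0r.
Qed.

End Retraction.

Section Extension.
Context {R : realType} {m k : nat}.
Local Notation n := (m + k)%N.
Local Notation base := 'rV[R]_n.
Local Notation TB := (vel_space R n).
Local Notation TBM := (vel_space R n * 'rV[R]_k)%type.
Variables (Q : set base) (D : base -> set base) (X : 'I_n -> base -> base).
Variable theta : 'I_n -> base -> 'cV[R]_n.
Hypothesis openQ : open Q.
Hypothesis frameX : adapted_frame Q D X.
Hypothesis coframe : dual_coframe Q X theta.

Local Notation TQ := (tangent_bundle Q).
Local Notation C := (constraint Q D).

(** Near [r y], [phi] is the restriction of a smooth [f], and near [(r y, phi (r y))], [Gh] is the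
    restriction of a smooth [h]. Since [r] takes values in [C], [(r z, f (r z))] lies in the image
    of the section, so [h] there equals [Gh] and the composite is smooth near [y]. *)
Lemma smooth_extension (phi : TB -> 'rV[R]_k) (Gh : TBM -> TBM) :
  smooth_on C phi -> smooth_on (section_image C phi) Gh ->
  smooth TQ (fun w => base_part phi Gh (retraction X theta w)).
Proof.
move=> sphi sGh; pose r := retraction X theta; have oTQ := open_TQ openQ.
have sr : smooth TQ r := smooth_retraction openQ frameX coframe.
apply: smooth_local => y Qy.
have Cr z : TQ z -> C (r z) := retraction_constraint theta frameX (w := z).
have [U [f [oU Ury sf fE]]] := sphi _ (Cr _ Qy).
have [U2 [h [oU2 U2y sh hE]]] := sGh (r y, phi (r y)) (conj (Cr _ Qy) erefl).
pose V1 := TQ `&` r @^-1` U.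
have oV1 : open V1 := open_smooth_preimage oTQ oU sr.
have sr1 : smooth V1 r by apply: smooth_subset sr => z [].
have sfr : smooth V1 (fun z => f (r z)).
  by apply: smooth_comp sf sr1 => // z [].
have sF : smooth V1 (fun z => (r z, f (r z))) by exact: smooth_pair.
(* [V1] is shrunk so that the lifted point stays in the domain of [h]. *)
pose V2 := V1 `&` (fun z => (r z, f (r z))) @^-1` U2.
have oV2 : open V2 := open_smooth_preimage oV1 oU2 sF.
have V1C z : V1 z -> f (r z) = phi (r z) by move=> [Qz Uz]; apply/fE/Cr.
have V1y : V1 y by [].
exists V2; split => //; first by split; rewrite //= V1C.
have shF : smooth V2 (fun z => h (r z, f (r z))).
  apply: smooth_comp sh _ => //; first by move=> z [].
  by apply: smooth_subset sF => z [].
have sg : smooth V2 (fun z => (h (r z, f (r z))).1).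
  by apply: (smooth_lin_comp (l := fst)) shF => // x; exact: cvg_fst.
apply: smooth_eq sg => // z [V1z U2z]; have [Qz _] := V1z.
rewrite hE //; last by split; [exact: Cr | exact: V1C].
by rewrite /base_part -V1C.
Qed.

End Extension.

(** * Passage between vakonomic solutions and Euler-Lagrange fields *)

Theorem theorem1 (R : realType) (m k : nat)
  (Q : set 'rV[R]_(m + k)) (D : 'rV[R]_(m + k) -> set 'rV[R]_(m + k))
  (X : 'I_(m + k) -> 'rV[R]_(m + k) -> 'rV[R]_(m + k))
  (theta : 'I_(m + k) -> 'rV[R]_(m + k) -> 'cV[R]_(m + k))
  (L : vel_space R (m + k) -> R)
  (openQ : open Q)
  (frameX : adapted_frame Q D X)
  (coframe : dual_coframe Q X theta)
  (nonintegrable : ~ integrable_distribution Q D)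
  (smoothL : smooth (tangent_bundle Q) L)
  (regularL : regular_lagrangian Q L) :
  let TQ := tangent_bundle Q in
  let C := constraint Q D in
  (forall (phi : vel_space R (m + k) -> 'rV[R]_k)
      (Gh : vel_space R (m + k) * 'rV[R]_k ->
            vel_space R (m + k) * 'rV[R]_k),
    smooth_on C phi ->
    vak_solution_on X theta L (section_image C phi) Gh ->
    (forall w, C w -> tangent_to C w (base_part phi Gh w)) ->
    (forall z, section_image C phi z ->
       tangent_to (section_image C phi) z (Gh z)) ->
    forall (N : set (vel_space R (m + k)))
      (Phi : vel_space R (m + k) -> 'rV[R]_k),
      open N -> C `<=` N -> N `<=` TQ -> smooth N Phi ->
      (forall w, C w -> Phi w = phi w) ->
      exists Gt : vel_space R (m + k) -> vel_space R (m + k),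
        EL_field X theta N C (modified_lagrangian theta L Phi) Gt /\
        (forall w, C w -> Gt w = base_part phi Gh w))
  /\
  (forall (N S : set (vel_space R (m + k)))
      (Phi : vel_space R (m + k) -> 'rV[R]_k)
      (Gt : vel_space R (m + k) -> vel_space R (m + k)),
    open N -> C `<=` S -> S `<=` N -> N `<=` TQ -> smooth N Phi ->
    EL_field X theta N S (modified_lagrangian theta L Phi) Gt ->
    (forall w, C w -> tangent_to C w (Gt w)) ->
    second_order_on C Gt ->
    vak_solution_on X theta L (section_image C Phi) (pushforward_field Phi Gt)).
Proof.
move=> TQ C; split.
  move=> phi Gh sphi [sGh ham] tanC tanI N Phi oN CN NTQ sPhi PhiE.
  exists (fun w => base_part phi Gh (retraction X theta w)).
  have rE w : C w -> base_part phi Gh (retraction X theta w) = base_part phi Gh w.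
    by move=> Cw; rewrite (retraction_id frameX coframe).
  split=> //; split.
    apply: smooth_subset NTQ _.
    exact: (smooth_extension openQ frameX coframe).
  move=> w Cw; rewrite rE //; have [Qw _] := Cw; have Nw := CN _ Cw.
  have Iw : section_image C phi (w, phi w) by [].
  have := ham _ Iw; have := tanI _ Iw; have := tanC _ Cw.
  rewrite /base_part; case: (Gh (w, phi w)) => g A /= tg tgA hgA.
  have gw : g.1 = w.2 := vak_second_order openQ coframe smoothL regularL Qw hgA.
  have vx a : quasi_velocity theta (rshift m a) w = 0.
    exact: (constraint_vel_eq0 frameX coframe).
  have vg a : 'D_g (quasi_velocity theta (rshift m a)) w = 0.
    apply: (derive_tangent tg); last exact: (differentiable_vel openQ coframe).
    by move=> y Cy; exact: (constraint_vel_eq0 frameX coframe).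
  apply/(EL_vak_equiv openQ coframe smoothL oN NTQ sPhi Nw gw vx vg).
  (* The vakonomic equation is known for [(g, A)]; tangency to the image of the section, where
     [mu = Phi], identifies [A] with the derivative of [Phi] along [g]. *)
  suff <- : A = 'D_g Phi w by rewrite PhiE.
  apply: (tangent_graph tgA); last exact: smooth_differentiable Nw.
  by move=> z [Cz ->]; rewrite PhiE.
move=> N S Phi Gt oN CS SN NTQ sPhi [sGt ham] tanC so.
have CN w : C w -> N w by move=> Cw; apply/SN/CS.
have pushE z : N z.1 ->
    pushforward_field Phi Gt z = (Gt z.1, 'D_(Gt z.1) Phi z.1).
  move=> Nz; have dPhi := smooth_differentiable sPhi Nz.
  have did : differentiable (id : vel_space R (m + k) -> _) z.1 by [].
  rewrite /pushforward_field (diff_pair did dPhi) deriveE //.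
  by rewrite (diff_val (f := id)).
split.
  (* The pushforward formula makes sense over all of [N] and does not involve [mu], so it is its own
     smooth extension to the preimage of [N]. *)
  move=> z [Cz _]; pose U : set (vel_space R (m + k) * 'rV[R]_k) := fst @^-1` N.
  have oU : open U by apply: open_comp oN => y _; exact: cvg_fst.
  exists U, (pushforward_field Phi Gt); split => //; first exact: CN.
  have sP : smooth N (fun w => (Gt w, 'D_(Gt w) Phi w)).
    by apply: smooth_pair => //; exact: smooth_derive_along.
  have : smooth U (fun z => (Gt z.1, 'D_(Gt z.1) Phi z.1)).
    apply: (smooth_comp (U' := N) (g := fst)) sP _ => //.
    apply: (smooth_lin_comp (l := fst)) (smooth_id _) => // y.
    exact: cvg_fst.
  by apply: smooth_eq => // y Uy; rewrite pushE.
case=> w nu [/= Cw ->]; rewrite pushE; last exact: CN.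
have [Qw _] := Cw; have Nw := CN _ Cw.
(* The modified Lagrangian may fail to be regular, so [g.1 = w.2] comes from the second-order
   hypothesis [so]. *)
apply/(EL_vak_equiv openQ coframe smoothL oN NTQ sPhi Nw (so _ Cw)).
- by move=> a; exact: (constraint_vel_eq0 frameX coframe).
- move=> a; apply: (derive_tangent (tanC _ Cw)); last exact: (differentiable_vel openQ coframe).
  by move=> y Cy; exact: (constraint_vel_eq0 frameX coframe).
exact/ham/CS.
Qed.
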